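(* Let $A,B,C,D,E,F\in\mathbb{R}$ with $A,B,C$ not all zero, let $f(x,y)=Ax^2+2Bxy+Cy^2+2Dx+2Ey+F$, and let $\mathcal{K}=\{(x,y)\in\mathbb{R}^2 : f(x,y)=0\}$. Put $$\omega=A+C,\qquad \delta=\begin{vmatrix} A & B \\ B & C \end{vmatrix}=AC-B^2,\qquad \Delta=\begin{vmatrix} A & B & D \\ B & C & E \\ D & E & F \end{vmatrix}.$$ Suppose that the conic has a unique center $O'$ (equivalently, $\delta\neq 0$). Then the nature of $\mathcal{K}$ is determined as follows. If $\delta<0$: (i) if $\Delta<0$ or $\Delta>0$, then $\mathcal{K}$ is a hyperbola; (ii) if $\Delta=0$, then $\mathcal{K}$ consists of two lines concurrent at $O'$. If $\delta>0$: (iii) if $\Delta<0$ and $\omega<0$, then $\mathcal{K}=\emptyset$; (iv) if $\Delta<0$ and $\omega>0$, then $\mathcal{K}$ is an ellipse or a circle; (v) if $\Delta=0$, then $\mathcal{K}=\{O'\}$; (vi) if $\Delta>0$ and $\omega<0$, then $\mathcal{K}$ is an ellipse or a circle; (vii) if $\Delta>0$ and $\omega>0$, then $\mathcal{K}=\emptyset$.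
   Context: A center of the conic $f(x,y)=0$ is a point $(h,k)\in\mathbb{R}^2$ that solves the linear system $Ah+Bk=-D$, $Bh+Ck=-E$ (equivalently, both partial derivatives of $f$ vanish at $(h,k)$). A center need not lie on the conic. The two concurrent lines in (ii) are distinct. *)

(* Defs.v *)
From HB Require Import structures.
From mathcomp Require Import all_boot all_order all_algebra.
From mathcomp Require Import classical_sets reals.
Set Implicit Arguments.
Unset Strict Implicit.
Unset Printing Implicit Defensive.
Import Order.TTheory GRing.Theory Num.Theory.
Local Open Scope classical_set_scope.
Local Open Scope ring_scope.

Definition mx_of_rows (R : realType) (n : nat) (s : seq (seq R)) : 'M[R]_n :=
  \matrix_(i, j) nth 0 (nth [::] s i) j.

(* The library norm on R * R is the sup norm, hence an explicit Euclidean
   distance. *)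
Definition dist (R : realType) (P Q : R * R) : R :=
  Num.sqrt ((P.1 - Q.1) ^+ 2 + (P.2 - Q.2) ^+ 2).

Definition is_line (R : realType) (L : set (R * R)) : Prop :=
  exists a b c : R, (a, b) != (0, 0) /\
    L = [set P : R * R | a * P.1 + b * P.2 = c].

Definition is_circle (R : realType) (K : set (R * R)) : Prop :=
  exists (O : R * R) (r : R), 0 < r /\ K = [set P : R * R | dist P O = r].

(* Ellipses and hyperbolas are given by their foci F1, F2 and by the length 2a
   of the focal, respectively transverse, axis.  The foci of an ellipse are
   distinct, so that circles are not ellipses here. *)
Definition is_ellipse (R : realType) (K : set (R * R)) : Prop :=
  exists (F1 F2 : R * R) (a : R), [/\ F1 != F2, dist F1 F2 < 2 * a &
    K = [set P : R * R | dist P F1 + dist P F2 = 2 * a]].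

Definition is_hyperbola (R : realType) (K : set (R * R)) : Prop :=
  exists (F1 F2 : R * R) (a : R), [/\ 0 < a, 2 * a < dist F1 F2 &
    K = [set P : R * R | `|dist P F1 - dist P F2| = 2 * a]].

Definition two_lines_concurrent_at (R : realType) (O : R * R)
    (K : set (R * R)) : Prop :=
  exists L1 L2 : set (R * R),
    [/\ is_line L1, is_line L2, L1 <> L2, L1 O /\ L2 O & K = L1 `|` L2].

Definition conic_fun (R : realType) (A B C D E F x y : R) : R :=
  A * x ^+ 2 + 2 * B * x * y + C * y ^+ 2 + 2 * D * x + 2 * E * y + F.

Definition conic (R : realType) (A B C D E F : R) : set (R * R) :=
  [set P : R * R | conic_fun A B C D E F P.1 P.2 = 0].

Definition is_center (R : realType) (A B C D E : R) (O : R * R) : Prop :=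
  A * O.1 + B * O.2 = - D /\ B * O.1 + C * O.2 = - E.

Definition conic_omega (R : realType) (A C : R) : R := A + C.

Definition conic_delta (R : realType) (A B C : R) : R :=
  \det (mx_of_rows 2 [:: [:: A; B];
                         [:: B; C]]).

Definition conic_Delta (R : realType) (A B C D E F : R) : R :=
  \det (mx_of_rows 3 [:: [:: A; B; D];
                         [:: B; C; E];
                         [:: D; E; F]]).

Lemma conic_deltaE (R : realType) (A B C : R) :
  conic_delta A B C = A * C - B ^+ 2.
Proof.
rewrite /conic_delta (expand_det_row _ ord0) !big_ord_recl big_ord0 /cofactor.
by rewrite !det_mx11 !mxE /= addr0 expr0 mul1r expr1 mulN1r mulrN expr2.
Qed.

(* Main.v *)
Require Import Defs.
From HB Require Import structures.
From mathcomp Require Import all_boot all_order all_algebra.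
From mathcomp Require Import classical_sets reals.
From mathcomp Require Import ring lra.
Set Implicit Arguments.
Unset Strict Implicit.
Unset Printing Implicit Defensive.
Import Order.TTheory GRing.Theory Num.Theory.
Local Open Scope classical_set_scope.
Local Open Scope ring_scope.

(** Centred at [(h, k)], [f] becomes [q(u, v) + G] with [q] the quadratic part
and [G = Delta / delta].  For foci [(h, k) +- (p, q)] and [a > 0], squaring
twice turns both [d1 + d2 = 2 a] and [|d1 - d2| = 2 a] into
[a^2 (u^2 + v^2) - (p u + q v)^2 = a^2 (a^2 - p^2 - q^2)], the former
when [p^2 + q^2 < a^2] and the latter when [p^2 + q^2 > a^2].
Multiplying the conic by [t = - G / delta] makes its constant term the opposite
of the determinant of its quadratic part, so that it has this form as soon as
[a^2] is the larger eigenvalue of the rescaled matrix; the second eigenvalue is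
[a^2 - p^2 - q^2], whose sign separates ellipses from hyperbolas. *)

(** * Determinants and centers *)

Lemma conic_DeltaE (R : realType) (A B C D E F : R) :
  conic_Delta A B C D E F =
  A * (C * F - E ^+ 2) - B * (B * F - D * E) + D * (B * E - C * D).
Proof.
rewrite /conic_Delta (expand_det_row _ ord0) !big_ord_recl big_ord0 /cofactor.
rewrite !(expand_det_row _ ord0) !big_ord_recl !big_ord0 /cofactor.
rewrite !det_mx11 !mxE /= /bump /=.
ring.
Qed.

(** The linear terms cancel at a center, and the remaining constant is the value of [f] at [O]. *)
Lemma conic_fun_center (R : realType) (A B C D E F x y : R) (O : R * R) :
  is_center A B C D E O ->
  conic_fun A B C D E F x y =
  A * (x - O.1) ^+ 2 + 2 * B * (x - O.1) * (y - O.2) + C * (y - O.2) ^+ 2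
  + (D * O.1 + E * O.2 + F).
Proof.
move=> [hD hE]; rewrite /conic_fun.
have -> : D = - (A * O.1 + B * O.2) by rewrite hD opprK.
have -> : E = - (B * O.1 + C * O.2) by rewrite hE opprK.
ring.
Qed.

(** Adding [O.1] times the first column and [O.2] times the second to the third turns the latter
    into [(0, 0, D * O.1 + E * O.2 + F)]. *)
Lemma conic_Delta_center (R : realType) (A B C D E F : R) (O : R * R) :
  is_center A B C D E O ->
  conic_Delta A B C D E F =
  conic_delta A B C * (D * O.1 + E * O.2 + F).
Proof.
move=> [hD hE]; rewrite conic_DeltaE conic_deltaE.
have -> : D = - (A * O.1 + B * O.2) by rewrite hD opprK.
have -> : E = - (B * O.1 + C * O.2) by rewrite hE opprK.
ring.
Qed.

Lemma unique_center_iff (R : realType) (A B C D E : R) :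
  ~ [/\ A = 0, B = 0 & C = 0] ->
  (exists! O, is_center A B C D E O) <-> conic_delta A B C <> 0.
Proof.
rewrite conic_deltaE => hABC; split=> [[[h k] [[/= hD hE] uO]] d0|/eqP d0].
  (* A center translated by a kernel vector is again a center, so uniqueness makes the kernel
     trivial. When the determinant vanishes, [(- B, A)] and [(C, - B)] lie in the kernel. *)
  have cU (u v : R) : A * u + B * v = 0 -> B * u + C * v = 0 -> u = 0 /\ v = 0.
    move=> e1 e2; have /uO [] : is_center A B C D E (h + u, k + v).
      by split=> /=; lra.
    by lra.
  have [B0 A0] : - B = 0 /\ A = 0 by apply: cU; lra.
  have [C0 _] : C = 0 /\ - B = 0 by apply: cU; lra.
  by apply: hABC; split=> //; lra.
(* Cramer's rule. *)
exists ((B * E - C * D) / (A * C - B ^+ 2), (B * D - A * E) / (A * C - B ^+ 2)).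
split=> [|[x y] [/= hD hE]]; first by split=> /=; field.
have -> : D = - (A * x + B * y) by rewrite hD opprK.
have -> : E = - (B * x + C * y) by rewrite hE opprK.
by congr pair; field.
Qed.

(** * Bifocal equations of ellipses, hyperbolas and circles *)

Lemma dist_ge0 (R : realType) (P Q : R * R) : 0 <= dist P Q.
Proof. exact: sqrtr_ge0. Qed.

Lemma sqr_dist (R : realType) (P Q : R * R) :
  dist P Q ^+ 2 = (P.1 - Q.1) ^+ 2 + (P.2 - Q.2) ^+ 2.
Proof. by rewrite sqr_sqrtr // addr_ge0 // sqr_ge0. Qed.

Lemma dist_opp_foci (R : realType) (h k p q : R) :
  dist (h + p, k + q) (h - p, k - q) = 2 * Num.sqrt (p ^+ 2 + q ^+ 2).
Proof.
have -> : dist (h + p, k + q) (h - p, k - q) =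
    Num.sqrt (2 ^+ 2 * (p ^+ 2 + q ^+ 2)) by congr Num.sqrt => /=; ring.
by rewrite sqrtrM ?sqr_ge0 // sqrtr_sqr ger0_norm.
Qed.

Definition bifocal_conic (R : realType) (h k p q a : R) : set (R * R) :=
  [set P : R * R | a ^+ 2 * ((P.1 - h) ^+ 2 + (P.2 - k) ^+ 2)
     - (p * (P.1 - h) + q * (P.2 - k)) ^+ 2
     = a ^+ 2 * (a ^+ 2 - p ^+ 2 - q ^+ 2)].

Lemma cauchy_schwarz2 (R : realType) (p q u v : R) :
  (p * u + q * v) ^+ 2 <= (p ^+ 2 + q ^+ 2) * (u ^+ 2 + v ^+ 2).
Proof. by have := sqr_ge0 (p * v - q * u); lra. Qed.

(** With [S = u^2 + v^2 + p^2 + q^2], the squared distances are [S - 2 (p u + q v)] and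
    [S + 2 (p u + q v)]. Squaring [d1 + d2 = 2 a] gives [d1 d2 = 2 a^2 - S], and squaring
    [|d1 - d2| = 2 a] gives [d1 d2 = S - 2 a^2]; one more squaring merges the two cases. *)
Lemma prod_dist_foci (R : realType) (h k p q a : R) (P : R * R) :
  ((dist P (h + p, k + q) * dist P (h - p, k - q)) ^+ 2 =
   (2 * a ^+ 2 - (P.1 - h) ^+ 2 - (P.2 - k) ^+ 2 - p ^+ 2 - q ^+ 2) ^+ 2)
  <-> bifocal_conic h k p q a P.
Proof.
case: P => x y; rewrite exprMn !sqr_dist /bifocal_conic /=.
by split=> e; lra.
Qed.

Lemma is_ellipse_bifocal (R : realType) (h k p q a : R) :
  0 < a -> (p, q) != (0, 0) -> p ^+ 2 + q ^+ 2 < a ^+ 2 ->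
  is_ellipse (bifocal_conic h k p q a).
Proof.
move=> a0 c0 ca; exists (h + p, k + q), (h - p, k - q), a; split.
- apply: contra c0 => /eqP [e1 e2]; apply/eqP; congr pair; lra.
- rewrite dist_opp_foci ltr_pM2l //.
  by rewrite -[ltRHS](gtr0_norm a0) -sqrtr_sqr ltr_sqrt // exprn_gt0.
apply/seteqP; split=> -[x y].
  move=> e; have /prod_dist_foci := e; rewrite /bifocal_conic /= in e *.
  have := @sqr_dist _ (x, y) (h + p, k + q).
  have := @sqr_dist _ (x, y) (h - p, k - q).
  have := dist_ge0 (x, y) (h + p, k + q).
  have := dist_ge0 (x, y) (h - p, k - q).
  set d1 := dist _ (h + p, _); set d2 := dist _ _ => /= d2p d1p d2E d1E /eqP.
  have cs := cauchy_schwarz2 p q (x - h) (y - k).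
  (* With [p^2 + q^2 < a^2], this makes [2 a^2 - S] nonnegative, which selects the sign
     [d1 d2 = 2 a^2 - S] when the square is removed. *)
  have uva : (x - h) ^+ 2 + (y - k) ^+ 2 <= a ^+ 2.
    have b0 : 0 < a ^+ 2 - (p ^+ 2 + q ^+ 2) by lra.
    by rewrite -(ler_pM2l b0); lra.
  rewrite eqrXn2 //; [|exact: mulr_ge0|lra] => /eqP dd.
  apply/eqP; rewrite -(@eqrXn2 _ 2) //; [|lra|lra].
  by apply/eqP; lra.
move=> /= e; apply/prod_dist_foci => /=.
have := @sqr_dist _ (x, y) (h + p, k + q).
have := @sqr_dist _ (x, y) (h - p, k - q).
set d1 := dist _ (h + p, _) in e *; set d2 := dist _ _ in e * => /= d2E d1E.
congr (_ ^+ 2).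
have : (d1 + d2) ^+ 2 = (2 * a) ^+ 2 by rewrite e.
by lra.
Qed.

Lemma is_hyperbola_bifocal (R : realType) (h k p q a : R) :
  0 < a -> a ^+ 2 < p ^+ 2 + q ^+ 2 -> is_hyperbola (bifocal_conic h k p q a).
Proof.
move=> a0 ca; exists (h + p, k + q), (h - p, k - q), a; split=> //.
  rewrite dist_opp_foci ltr_pM2l //.
  rewrite -[ltLHS](gtr0_norm a0) -sqrtr_sqr ltr_sqrt //.
  by have := sqr_ge0 a; lra.
apply/seteqP; split=> -[x y].
  move=> e; have /prod_dist_foci := e; rewrite /bifocal_conic /= in e *.
  have := @sqr_dist _ (x, y) (h + p, k + q).
  have := @sqr_dist _ (x, y) (h - p, k - q).
  have := dist_ge0 (x, y) (h + p, k + q).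
  have := dist_ge0 (x, y) (h - p, k - q).
  set d1 := dist _ (h + p, _); set d2 := dist _ _ => /= d2p d1p d2E d1E /eqP.
  have cs := cauchy_schwarz2 p q (x - h) (y - k).
  (* Here the inequality is reversed, so [S - 2 a^2] is nonnegative and the other sign is
     selected. *)
  have uva : a ^+ 2 <= (x - h) ^+ 2 + (y - k) ^+ 2.
    have b0 : 0 < p ^+ 2 + q ^+ 2 - a ^+ 2 by lra.
    by rewrite -(ler_pM2l b0); lra.
  rewrite -[X in _ == X]sqrrN.
  rewrite eqrXn2 //; [|exact: mulr_ge0|lra] => /eqP dd.
  apply/eqP; rewrite -(@eqrXn2 _ 2) //; [|lra].
  by rewrite real_normK ?num_real //; apply/eqP; lra.
move=> /= e; apply/prod_dist_foci => /=.
have := @sqr_dist _ (x, y) (h + p, k + q).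
have := @sqr_dist _ (x, y) (h - p, k - q).
set d1 := dist _ (h + p, _) in e *; set d2 := dist _ _ in e * => /= d2E d1E.
rewrite -[RHS]sqrrN; congr (_ ^+ 2).
have : `|d1 - d2| ^+ 2 = (2 * a) ^+ 2 by rewrite e.
by rewrite real_normK ?num_real //; lra.
Qed.

Lemma is_circle_bifocal (R : realType) (h k a : R) :
  0 < a -> is_circle (bifocal_conic h k 0 0 a).
Proof.
move=> a0; exists (h, k), a; split=> //.
have a20 : a ^+ 2 != 0 by rewrite expf_neq0 ?gt_eqF.
apply/seteqP; split=> -[x y]; rewrite /bifocal_conic /= => e.
  apply/eqP; rewrite -(@eqrXn2 _ 2) ?dist_ge0 //; last lra.
  rewrite sqr_dist /=; apply/eqP/(mulfI a20); lra.
have : dist (x, y) (h, k) ^+ 2 = a ^+ 2 by rewrite e.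
by rewrite sqr_dist /= => ->; ring.
Qed.

(* [l] is the larger eigenvalue of the symmetric matrix [A B; B C]. *)
Lemma sym_mx2_eigen (R : realType) (A B C : R) :
  exists l p q : R, [/\ p ^+ 2 = l - A, q ^+ 2 = l - C & p * q = - B].
Proof.
(* The gap between the two eigenvalues, from the discriminant of the characteristic polynomial. *)
pose s := Num.sqrt ((A - C) ^+ 2 + 4 * B ^+ 2).
have s2 : s ^+ 2 = (A - C) ^+ 2 + 4 * B ^+ 2.
  by rewrite sqr_sqrtr //; have := sqr_ge0 (A - C); have := sqr_ge0 B; lra.
have : `|A - C| <= s.
  rewrite -sqrtr_sqr ler_wsqrtr //; have := sqr_ge0 B; lra.
rewrite ler_norml => /andP [sl sr].
pose l := (A + C + s) / 2.
have lA : 0 <= l - A by rewrite /l; lra.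
have lC : 0 <= l - C by rewrite /l; lra.
have lE : (l - A) * (l - C) = B ^+ 2 by rewrite /l; lra.
have sE : Num.sqrt (l - A) * Num.sqrt (l - C) = `|B|.
  by rewrite -sqrtrM // lE sqrtr_sqr.
(* The nonnegative roots have product [|B|]; the sign of [q] is chosen to make the product [- B]. *)
have [B0|B0] := leP 0 B.
  exists l, (Num.sqrt (l - A)), (- Num.sqrt (l - C)).
  by rewrite sqrrN !sqr_sqrtr // mulrN sE ger0_norm.
exists l, (Num.sqrt (l - A)), (Num.sqrt (l - C)).
by rewrite !sqr_sqrtr // sE ltr0_norm.
Qed.

(** * Classification of conics centered at [(h, k)] *)

Section CentralConic.
Variables (R : realType) (A B C G h k : R).

Definition central_conic : set (R * R) :=
  [set P : R * R | A * (P.1 - h) ^+ 2 + 2 * B * (P.1 - h) * (P.2 - k)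
                   + C * (P.2 - k) ^+ 2 + G = 0].

Local Notation delta := (A * C - B ^+ 2).

(** Let [M] be the matrix of the form multiplied by [t], and [l] its larger eigenvalue. Then
    [l I - M] has rank at most one and is the square of the linear form [p u + q v], so [M] gives
    [l (u^2 + v^2) - (p u + q v)^2]. Comparing traces, the other eigenvalue is [l - p^2 - q^2]. The
    sign of [l] is still open, hence the condition [a ^+ 2 = l]. *)
Lemma central_conic_bifocal :
  delta != 0 -> G != 0 ->
  let t := - G / delta in
  exists l p q : R, [/\ p ^+ 2 = l - t * A, q ^+ 2 = l - t * C,
    l * (l - p ^+ 2 - q ^+ 2) = t ^+ 2 * delta &
    forall a, a ^+ 2 = l -> central_conic = bifocal_conic h k p q a].
Proof.
move=> d0 G0 t; have t0 : t != 0.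
  by rewrite mulf_neq0 ?oppr_eq0 ?invr_eq0.
have tG : t * G = - (t ^+ 2 * delta) by rewrite /t; field.
have [l [p [q [pE qE pqE]]]] := sym_mx2_eigen (t * A) (t * B) (t * C).
have lE : l * (l - p ^+ 2 - q ^+ 2) = t ^+ 2 * delta.
  have : (p * q) ^+ 2 = (l - t * A) * (l - t * C) by rewrite exprMn pE qE.
  by rewrite pqE pE qE; lra.
exists l, p, q; split=> // a aE.
have tf x y : t * (A * (x - h) ^+ 2 + 2 * B * (x - h) * (y - k)
      + C * (y - k) ^+ 2 + G) =
    (a ^+ 2 * ((x - h) ^+ 2 + (y - k) ^+ 2) - (p * (x - h) + q * (y - k)) ^+ 2)
    - (a ^+ 2 * (a ^+ 2 - p ^+ 2 - q ^+ 2)).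
  have -> : (p * (x - h) + q * (y - k)) ^+ 2 = p ^+ 2 * (x - h) ^+ 2 +
      2 * (p * q) * ((x - h) * (y - k)) + q ^+ 2 * (y - k) ^+ 2 by ring.
  by rewrite aE lE pqE pE qE mulrDr tG; ring.
apply/seteqP; split=> -[x y]; rewrite /central_conic /bifocal_conic /= => e.
  by apply/eqP; rewrite -subr_eq0 -tf e mulr0.
by apply: (mulfI t0); rewrite tf e mulr0 subrr.
Qed.

Lemma central_conic_hyperbola :
  delta < 0 -> G != 0 -> is_hyperbola central_conic.
Proof.
move=> d0 G0; have dn : delta != 0 by rewrite lt_eqF.
have [l [p [q [pE qE lE cE]]]] := central_conic_bifocal dn G0.
have : l * (l - p ^+ 2 - q ^+ 2) < 0.
  rewrite lE pmulr_rlt0 // exprn_even_gt0 //=.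
  by rewrite mulf_neq0 ?oppr_eq0 ?invr_eq0.
have p0 := sqr_ge0 p; have q0 := sqr_ge0 q => ll.
(* The eigenvalues have opposite signs, and [l] is the larger one. *)
have l0 : 0 < l.
  rewrite ltNge; apply/negP => l0; move: ll; apply/negP; rewrite -leNgt.
  by apply: mulr_le0 => //; lra.
have a2 : Num.sqrt l ^+ 2 = l by rewrite sqr_sqrtr // ltW.
rewrite (cE _ a2); apply: is_hyperbola_bifocal; first by rewrite sqrtr_gt0.
by move: ll; rewrite pmulr_rlt0 // a2; lra.
Qed.

Lemma central_conic_ellipse :
  0 < delta -> G * (A + C) < 0 ->
  is_ellipse central_conic \/ is_circle central_conic.
Proof.
move=> d0 Gw; have dn : delta != 0 by rewrite gt_eqF.
have G0 : G != 0 by apply/eqP => G0; move: Gw; rewrite G0 mul0r ltxx.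
have [l [p [q [pE qE lE cE]]]] := central_conic_bifocal dn G0.
set t := - G / delta in pE qE lE.
have tw : 0 < t * (A + C).
  by rewrite /t mulrAC mulNr divr_gt0 // oppr_gt0.
have p0 := sqr_ge0 p; have q0 := sqr_ge0 q.
(* The trace [t * (A + C)] equals [2 l - p^2 - q^2] and is positive. *)
have l0 : 0 < l by lra.
have : 0 < l * (l - p ^+ 2 - q ^+ 2).
  rewrite lE mulr_gt0 // exprn_even_gt0 //=.
  by rewrite mulf_neq0 ?oppr_eq0 ?invr_eq0.
rewrite pmulr_rgt0 // => cl.
have a2 : Num.sqrt l ^+ 2 = l by rewrite sqr_sqrtr // ltW.
have a0 : 0 < Num.sqrt l by rewrite sqrtr_gt0.
(* Coinciding foci, that is a double eigenvalue, give the circle. *)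
rewrite (cE _ a2); have [[-> ->]|c0] := eqVneq (p, q) (0, 0).
  by right; apply: is_circle_bifocal.
by left; apply: is_ellipse_bifocal => //; rewrite a2; lra.
Qed.

(** By Cayley-Hamilton, [omega M = M^2 + delta I], so the form times the trace is
    [|M w|^2 + delta |w|^2] at [w = (u, v)]. The factor [A + C] treats positive and negative
    definite forms together. *)
Lemma definite_form_gt0 (u v : R) :
  0 < delta -> (u, v) != (0, 0) ->
  0 < (A + C) * (A * u ^+ 2 + 2 * B * u * v + C * v ^+ 2).
Proof.
move=> d0 uv0.
have -> : (A + C) * (A * u ^+ 2 + 2 * B * u * v + C * v ^+ 2) =
  (A * u + B * v) ^+ 2 + (B * u + C * v) ^+ 2 + delta * (u ^+ 2 + v ^+ 2) by ring.
apply: ltr_wpDl; first by rewrite addr_ge0 ?sqr_ge0.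
apply: mulr_gt0 => //; rewrite lt0r addr_ge0 ?sqr_ge0 // andbT.
by rewrite paddr_eq0 ?sqr_ge0 // !sqrf_eq0.
Qed.

Lemma central_conic_set0 :
  0 < delta -> 0 < G * (A + C) -> central_conic = set0.
Proof.
move=> d0 Gw; apply/seteqP; split=> // -[x y]; rewrite /central_conic /= => e.
have e' : (A + C) * (A * (x - h) ^+ 2 + 2 * B * (x - h) * (y - k)
            + C * (y - k) ^+ 2) + G * (A + C) = 0.
  by rewrite [G * _]mulrC -mulrDr e mulr0.
have [[e1 e2]|c0] := eqVneq (x - h, y - k) (0, 0).
  by move: e'; rewrite e1 e2; lra.
by have := definite_form_gt0 d0 c0; lra.
Qed.

Lemma central_conic_set1 : 0 < delta -> G = 0 -> central_conic = [set (h, k)].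
Proof.
move=> d0 G0; apply/seteqP; split=> [[x y]|_ ->]; last first.
  by rewrite /central_conic /= G0; ring.
rewrite /central_conic /= G0 addr0 => e.
have [[e1 e2]|c0] := eqVneq (x - h, y - k) (0, 0); first by congr pair; lra.
by have := definite_form_gt0 d0 c0; rewrite e mulr0 ltxx.
Qed.

Lemma two_lines_of_factors (K : set (R * R)) (a b c d : R) :
  a * d - b * c != 0 ->
  (forall x y, K (x, y) <->
    (a * (x - h) + b * (y - k)) * (c * (x - h) + d * (y - k)) = 0) ->
  two_lines_concurrent_at (h, k) K.
Proof.
move=> ad KE.
pose L (a b : R) := [set P : R * R | a * P.1 + b * P.2 = a * h + b * k].
have L_line a' b' : (a', b') != (0, 0) -> is_line (L a' b').
  by move=> ab0; exists a', b', (a' * h + b' * k).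
exists (L a b), (L c d); split.
- by apply: L_line; apply: contra ad => /eqP [-> ->]; apply/eqP; ring.
- by apply: L_line; apply: contra ad => /eqP [-> ->]; apply/eqP; ring.
(* The point displaced from the center along the direction [(b, - a)] of the first line lies on the
   second only if [a d - b c = 0]. *)
- move=> LE; have : L a b (h + b, k - a) by rewrite /L /=; ring.
  rewrite LE /L /= => e; move/eqP: ad; apply; lra.
- by split.
apply/seteqP; split=> -[x y]; rewrite /L /=.
  move=> /KE /eqP; rewrite mulf_eq0 => /orP [] /eqP e; [left|right]; lra.
by move=> e; apply/KE/eqP; rewrite mulf_eq0; apply/orP;
  case: e => e; [left|right]; apply/eqP; lra.
Qed.

Lemma central_conic_two_lines :
  delta < 0 -> G = 0 -> two_lines_concurrent_at (h, k) central_conic.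
Proof.
move=> d0 G0; have [A0|A0] := eqVneq A 0.
  (* Without a square term in [u], the form is [v (2 B u + C v)]. *)
  apply: (@two_lines_of_factors _ 0 1 (2 * B) C).
    apply/eqP => e; have B0 : B = 0 by lra.
    by move: d0; rewrite A0 B0; lra.
  move=> x y; rewrite /central_conic /= A0 G0.
  by split=> e; rewrite -[RHS]e; ring.
(* Completing the square, [A] times the form is [(A u + B v)^2 - s^2 v^2], a difference of squares;
   [A] is cancelled at the end. *)
pose s := Num.sqrt (- delta).
have s2 : s ^+ 2 = - delta by rewrite sqr_sqrtr // oppr_ge0 ltW.
have s0 : 0 < s by rewrite sqrtr_gt0 oppr_gt0.
apply: (@two_lines_of_factors _ A (B + s) A (B - s)).
  have -> : A * (B - s) - (B + s) * A = A * (- (2 * s)) by ring.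
  by rewrite mulf_neq0 // oppr_eq0 mulf_neq0 // gt_eqF.
move=> x y; rewrite /central_conic /= G0.
have -> : (A * (x - h) + (B + s) * (y - k)) * (A * (x - h) + (B - s) * (y - k))
    = A * (A * (x - h) ^+ 2 + 2 * B * (x - h) * (y - k)
           + C * (y - k) ^+ 2 + 0) - (s ^+ 2 + delta) * (y - k) ^+ 2 by ring.
rewrite s2 addNr mul0r subr0; split=> [->|e]; first by rewrite mulr0.
by apply: (mulfI A0); rewrite e mulr0.
Qed.

End CentralConic.

(** * Reduction of the general conic to the centered one *)

Lemma conic_central (R : realType) (A B C D E F : R) (O : R * R) :
  is_center A B C D E O ->
  conic A B C D E F = central_conic A B C (D * O.1 + E * O.2 + F) O.1 O.2.
Proof.
move=> cO; apply/seteqP; split=> P;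
  by rewrite /conic /central_conic /= (conic_fun_center _ _ _ cO).
Qed.

Theorem mainTheorem1 (R : realType) (A B C D E F : R)
    (hABC : ~ [/\ A = 0, B = 0 & C = 0]) :
  let K := conic A B C D E F in
  let omega := conic_omega A C in
  let delta := conic_delta A B C in
  let Delta := conic_Delta A B C D E F in
  ((exists! O', is_center A B C D E O') <-> delta <> 0) /\
  forall O' : R * R, unique (is_center A B C D E) O' ->
    (delta < 0 ->
       (Delta < 0 \/ Delta > 0 -> is_hyperbola K) /\
       (Delta = 0 -> two_lines_concurrent_at O' K)) /\
    (delta > 0 ->
       [/\ Delta < 0 -> omega < 0 -> K = set0,
           Delta < 0 -> omega > 0 -> is_ellipse K \/ is_circle K,
           Delta = 0 -> K = [set O'],
           Delta > 0 -> omega < 0 -> is_ellipse K \/ is_circle K &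
           Delta > 0 -> omega > 0 -> K = set0]).
Proof.
move=> K omega delta Delta; split; first exact: unique_center_iff.
move=> O [cO _]; rewrite /K (conic_central _ cO) /Delta (conic_Delta_center _ cO).
rewrite -/delta; set G := _ + F; rewrite (surjective_pairing O) /=.
have dE : delta = A * C - B ^+ 2 := conic_deltaE A B C.
(* Now [Delta] reads [delta * G], so the sign of [delta] turns each condition on [Delta] into one on
   [G]. When [delta > 0] and [G] is nonzero, the sign of [G * omega] decides between the empty set
   and an ellipse or circle. *)
rewrite /omega /conic_omega; split=> d0; split.
- move=> DG; apply: central_conic_hyperbola; first by rewrite -dE.
  by apply/eqP => G0; move: DG; rewrite G0 mulr0 ltxx; case.
- move=> /eqP; rewrite mulf_eq0 lt_eqF //= => /eqP G0.
  by apply: central_conic_two_lines => //; rewrite -dE.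
- rewrite pmulr_rlt0 // => G0 w0.
  by apply: central_conic_set0; rewrite -?dE // nmulr_rgt0.
- rewrite pmulr_rlt0 // => G0 w0.
  by apply: central_conic_ellipse; rewrite -?dE // nmulr_rlt0.
- move=> /eqP; rewrite mulf_eq0 gt_eqF //= => /eqP G0.
  by apply: central_conic_set1 => //; rewrite -dE.
- rewrite pmulr_rgt0 // => G0 w0.
  by apply: central_conic_ellipse; rewrite -?dE // pmulr_rlt0.
- rewrite pmulr_rgt0 // => G0 w0.
  by apply: central_conic_set0; rewrite -?dE // pmulr_rgt0.
Qed.
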